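(* Let $\mathbb{X}$ be a real reflexive Banach space and $\mathbb{Y}$ a real normed space. If $T \in K(\mathbb{X},\mathbb{Y})$ is a smooth point of $K(\mathbb{X},\mathbb{Y})$, then $T$ attains its norm at a unique (up to scalar multiplication) vector $x_0 \in S_{\mathbb{X}}$, i.e. there is $x_0 \in S_{\mathbb{X}}$ with $\{x \in S_{\mathbb{X}} : \|Tx\| = \|T\|\} = \{x_0, -x_0\}$, and $Tx_0$ is a smooth point of $\mathbb{Y}$.
   Context: $S_{\mathbb{X}} = \{x \in \mathbb{X} : \|x\| = 1\}$. $K(\mathbb{X},\mathbb{Y})$ is the normed space of compact linear operators from $\mathbb{X}$ to $\mathbb{Y}$ with the operator norm. A non-zero element $u$ of a real normed space $\mathbb{Z}$ is a smooth point of $\mathbb{Z}$ if there is a unique linear functional $f \in \mathbb{Z}^*$ with $\|f\| = 1$ and $f(u) = \|u\|$. *)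

(* Defs.v *)
From HB Require Import structures.
From mathcomp Require Import all_boot all_order all_algebra.
From mathcomp Require Import all_classical all_reals all_analysis.
Import Order.TTheory GRing.Theory Num.Theory.
Import numFieldNormedType.Exports.

Set Implicit Arguments.
Unset Strict Implicit.
Unset Printing Implicit Defensive.

Local Open Scope classical_set_scope.
Local Open Scope ring_scope.

Definition unit_sphere (R : realType) (X : normedModType R) : set X :=
  [set x | `|x| = 1].
Arguments unit_sphere {R} X.

Definition unit_ball (R : realType) (X : normedModType R) : set X :=
  [set x | `|x| <= 1].
Arguments unit_ball {R} X.

(* As the domain is a normed space, continuous linear = bounded linear. *)
Definition blinear (R : realType) (X Y : normedModType R) : {pred X -> Y} :=
  mem [set f : X -> Y | linear f /\ continuous f].
Arguments blinear {R X Y} _.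

Record blinop (R : realType) (X Y : normedModType R) := BLinOp {
  blinop_fun :> X -> Y ;
  blinop_funP : blinop_fun \in blinear }.
Arguments blinop {R} X Y.

Section blinop_lmodule.
Context {R : realType} {X Y : normedModType R}.

HB.instance Definition _ := [isSub for @blinop_fun R X Y].
HB.instance Definition _ := [Choice of blinop X Y by <:].

Lemma blinearP (f : X -> Y) : f \in blinear <-> linear f /\ continuous f.
Proof. by rewrite inE. Qed.

Lemma blinear_submod_closed : submod_closed (@blinear R X Y).
Proof.
split=> [|a f g /blinearP[lf cf] /blinearP[lg cg]]; apply/blinearP; split.
- by move=> k u v; rewrite /= scaler0 addr0.
- exact: cst_continuous.
- move=> k u v; have E (h : X -> Y) w : (a *: f + h) w = a *: f w + h w by [].
  by rewrite !E lf lg !scalerDr !scalerA (mulrC k a) addrACA.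
- move=> x; apply: (@cvgD _ _ _ _ _ (a *: f) g _ _ _ (cg x)).
  exact: cvgZr (cf x).
Qed.

HB.instance Definition _ :=
  GRing.isSubmodClosed.Build _ _ (@blinear R X Y) blinear_submod_closed.
HB.instance Definition _ := [SubChoice_isSubLmodule of blinop X Y by <:].

Lemma blinop_linear (T : blinop X Y) : linear T.
Proof. by case/blinearP: (blinop_funP T). Qed.

HB.instance Definition _ (T : blinop X Y) :=
  GRing.isLinear.Build R X Y *:%R (blinop_fun T) (blinop_linear T).

Lemma blinop_continuous (T : blinop X Y) : continuous T.
Proof. by case/blinearP: (blinop_funP T). Qed.

Lemma blinopP (S T : blinop X Y) : S =1 T -> S = T.
Proof. by move=> ST; apply/val_inj/funext. Qed.

Lemma blinop_bounded (T : blinop X Y) :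
  exists M, forall x, `|T x| <= M * `|x|.
Proof.
have /linear_bounded_continuous/linear_boundedP := @blinop_continuous T.
by move=> /pinfty_ex_gt0[M _ TM]; exists M.
Qed.

(* The supremum runs over the closed ball rather than the sphere, which is empty
   when X = {0}. *)
Definition opnorm (T : blinop X Y) : R := sup [set `|T x| | x in unit_ball X].

Lemma opnorm_has_sup (T : blinop X Y) :
  has_sup [set `|T x| | x in unit_ball X].
Proof.
split; first by exists `|T 0|, 0 => //=; rewrite /unit_ball/= normr0.
have [M TM] := blinop_bounded T; exists `|M| => _ [x /= x1 <-].
rewrite (le_trans (TM x))// (le_trans (ler_norm _))// normrM normr_id.
by rewrite ler_piMr.
Qed.

Lemma opnorm_ub (T : blinop X Y) x : `|x| <= 1 -> `|T x| <= opnorm T.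
Proof.
by move=> x1; apply: (sup_upper_bound (opnorm_has_sup T)); exists x.
Qed.

Lemma opnorm_le (T : blinop X Y) M :
  (forall x, `|x| <= 1 -> `|T x| <= M) -> opnorm T <= M.
Proof.
move=> TM; apply: ge_sup; first by have [] := opnorm_has_sup T.
by move=> _ [x /= x1 <-]; exact: TM.
Qed.

Lemma opnorm_ge0 (T : blinop X Y) : 0 <= opnorm T.
Proof. by rewrite (le_trans _ (@opnorm_ub T 0 _)) ?normr0. Qed.

Lemma ler_opnorm (T : blinop X Y) x : `|T x| <= opnorm T * `|x|.
Proof.
have [->|x0] := eqVneq x 0; first by rewrite linear0 !normr0 mulr0.
have nx0 : 0 < `|x| by rewrite normr_gt0.
rewrite -ler_pdivrMr// mulrC -[X in X * _]ger0_norm ?invr_ge0//.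
rewrite -normrZ -linearZ opnorm_ub// normrZ ger0_norm ?invr_ge0//.
by rewrite mulVf// gt_eqF.
Qed.

Lemma opnormD (S T : blinop X Y) : opnorm (S + T) <= opnorm S + opnorm T.
Proof.
apply: opnorm_le => x x1.
by rewrite (le_trans (ler_normD (S x) (T x)))// lerD// opnorm_ub.
Qed.

Let opnormZ_le a (T : blinop X Y) : opnorm (a *: T) <= `|a| * opnorm T.
Proof.
apply: opnorm_le => x x1.
by rewrite [leLHS](normrZ a (T x)) ler_wpM2l// opnorm_ub.
Qed.

Lemma opnormZ a (T : blinop X Y) : opnorm (a *: T) = `|a| * opnorm T.
Proof.
apply/eqP; rewrite eq_le opnormZ_le/=.
have [->|a0] := eqVneq a 0; first by rewrite normr0 mul0r opnorm_ge0.
rewrite -ler_pdivlMl ?normr_gt0// -normfV -{1}(scalerK a0 T).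
exact: opnormZ_le.
Qed.

Lemma opnorm_eq0 (T : blinop X Y) : opnorm T = 0 -> T = 0.
Proof.
move=> T0; apply: blinopP => x; apply/eqP; rewrite -normr_le0.
by rewrite (le_trans (ler_opnorm T x))// T0 mul0r.
Qed.

HB.instance Definition _ :=
  Lmodule_isNormed.Build R (blinop X Y) opnormD opnormZ opnorm_eq0.

End blinop_lmodule.

Definition dual (R : realType) (Z : normedModType R) : normedModType R :=
  blinop Z R^o.

Section reflexive.
Context {R : realType} (X : normedModType R).

Lemma bidual_subproof (x : X) :
  (fun f : dual X => f x : R^o) \in blinear.
Proof.
apply/blinearP; split=> [k f g //|].
pose ev : dual X -> R^o := fun f => f x.
have lev : linear ev by [].
pose L : {linear dual X -> R^o} :=
  HB.pack ev (GRing.isLinear.Build R (dual X) R^o *:%R ev lev).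
apply: (@bounded_linear_continuous _ _ _ L).
apply/bounded_funP => r; exists (r * `|x|) => f fr.
by rewrite (le_trans (ler_opnorm f x))// ler_wpM2r.
Qed.

Definition bidual_embedding (x : X) : dual (dual X) :=
  BLinOp (bidual_subproof x).

Definition reflexive_space := set_surj setT setT bidual_embedding.

End reflexive.

(* Taking compact operators among the continuous linear maps loses nothing: a
   linear map sending the unit ball into a compact set is bounded. *)
Definition compact_op (R : realType) (X Y : normedModType R) :
    {pred blinop X Y} :=
  mem [set T : blinop X Y | precompact (T @` unit_ball X)].
Arguments compact_op {R X Y} _.

Record compop (R : realType) (X Y : normedModType R) := CompOp {
  compop_blinop :> blinop X Y ;
  compop_blinopP : compop_blinop \in compact_op }.
Arguments compop {R} X Y.

Section compop_normed.
Context {R : realType} {X Y : normedModType R}.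

HB.instance Definition _ := [isSub for @compop_blinop R X Y].
HB.instance Definition _ := [Choice of compop X Y by <:].

Lemma compact_opP (T : blinop X Y) :
  T \in compact_op <-> precompact (T @` unit_ball X).
Proof. by rewrite inE. Qed.

Lemma compact_op_submod_closed : submod_closed (@compact_op R X Y).
Proof.
split=> [|a S T /compact_opP[K SK [cK _]] /compact_opP[L TL [cL _]]];
  apply/compact_opP.
  apply: (@precompact_subset _ _ [set 0]) => [_ [x _ <-]//|].
  apply: compact_precompact; [exact: norm_hausdorff|exact: compact_set1].
apply: (@precompact_subset _ _ ((fun z => a *: z.1 + z.2) @` (K `*` L))).
  move=> _ [x x1 <-]; exists (S x, T x) => //=; split => /=.
    by apply: SK; exists x.
  by apply: TL; exists x.
apply: compact_precompact; first exact: norm_hausdorff.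
apply: continuous_compact; last exact: compact_setX.
apply: continuous_subspaceT => z.
by apply: cvgD; [apply: cvgZr; exact: cvg_fst|exact: cvg_snd].
Qed.

HB.instance Definition _ :=
  GRing.isSubmodClosed.Build _ _ (@compact_op R X Y) compact_op_submod_closed.
HB.instance Definition _ := [SubChoice_isSubLmodule of compop X Y by <:].

Definition compop_norm (T : compop X Y) : R := opnorm T.

Lemma compop_normD (S T : compop X Y) :
  compop_norm (S + T) <= compop_norm S + compop_norm T.
Proof. exact: opnormD. Qed.

Lemma compop_normZ a (T : compop X Y) :
  compop_norm (a *: T) = `|a| * compop_norm T.
Proof. exact: opnormZ. Qed.

Lemma compop_norm_eq0 (T : compop X Y) : compop_norm T = 0 -> T = 0.
Proof. by move=> /opnorm_eq0 T0; apply: val_inj. Qed.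

HB.instance Definition _ :=
  Lmodule_isNormed.Build R (compop X Y) compop_normD compop_normZ
    compop_norm_eq0.

End compop_normed.

Definition smooth_point (R : realType) (Z : normedModType R) (u : Z) :=
  u != 0 /\ exists! f : dual Z, `|f| = 1 /\ f u = `|u|.

(* Main.v *)
(* Norm attainment: by compactness the norm has a maximum [|y| >= |T|] on the
   closure of [T(B_X)]; if [g] norms [y], then [g \o T] attains its norm by
   reflexivity, and so does [T] at the same vector.
   Uniqueness and smoothness: whenever [|x| = 1], [|T x| = |T|] and [g] supports
   [T x], the functional [S |-> g (S x)] supports [T], so all these functionals
   coincide.  Testing two of them, for [(x, g)] and [(y, k)], on the rank-one
   operators [h(_) w] gives [h x * g w = h y * k w] for all [h] and [w], which
   forces [y] to be a multiple of [x], and [g = k] when [x = y]. *)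
From HB Require Import structures.
Require Import Defs.
From mathcomp Require Import all_boot all_order all_algebra.
From mathcomp Require Import all_classical all_reals all_analysis.
From mathcomp Require Import lra.
Import Order.TTheory GRing.Theory Num.Theory.
Import numFieldNormedType.Exports.

Set Implicit Arguments.
Unset Strict Implicit.
Unset Printing Implicit Defensive.

Local Open Scope classical_set_scope.
Local Open Scope ring_scope.

(** * The Hahn-Banach theorem for a sublinear functional [p] *)

Section hahn_banach.
Context (R : realType) (V : lmodType R) (p : V -> R).
Hypothesis pD : forall x y, p (x + y) <= p x + p y.
Hypothesis pZ : forall a x, 0 <= a -> p (a *: x) = a * p x.

(* Partial linear functionals below [p] are handled through their graphs;
   domination by [p] forces such a graph to be single-valued. *)
Definition dominated_graph (G : set (V * R^o)) :=
  (forall a u w, G u -> G w -> G (a *: u + w)) /\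
  (forall u, G u -> u.2 <= p u.1).

Lemma dominated_graph0 G : dominated_graph G -> G !=set0 -> G 0.
Proof.
by move=> [lG _] [u Gu]; have := lG (-1) u u Gu Gu; rewrite scaleN1r addNr.
Qed.

Lemma dominated_graphZ G a u : dominated_graph G -> G u -> G (a *: u).
Proof.
move=> gG Gu; have [lG _] := gG.
by rewrite -[a *: u]addr0; apply: lG => //; apply: dominated_graph0 => //; exists u.
Qed.

(** The difference of two points over [x] lies over 0, where [p] vanishes; taking it in both orders
    gives both inequalities. *)
Lemma dominated_graph_fun G x r s :
  dominated_graph G -> G (x, r) -> G (x, s) -> r = s.
Proof.
have p0 : p 0 = 0 by rewrite -(scale0r (0 : V)) pZ// mul0r.
suff le_rs r' s' : dominated_graph G -> G (x, r') -> G (x, s') -> r' <= s'.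
  by move=> gG Gr Gs; apply/eqP; rewrite eq_le !le_rs.
move=> [lG dG] Gr Gs; have := dG _ (lG (-1) _ _ Gs Gr).
by rewrite /= !scaleN1r addNr p0 addrC subr_le0.
Qed.

(** One-dimensional extension step: the value chosen at [v] is the supremum of the lower bounds that
    domination imposes on it. *)
Lemma dominated_graph_extend G v : dominated_graph G -> G 0 ->
  exists c : R^o, dominated_graph [set u + a *: (v, c) | u in G & a in setT].
Proof.
move=> gG G0; have [lG dG] := gG.
pose E := [set (u.2 - p (u.1 - v) : R) | u in G].
(* Every lower bound on the value at [v] lies below every upper bound, by subadditivity of [p] on
   [(u.1 - v) + (w.1 + v)]. *)
have sepE u w : G u -> G w -> u.2 - p (u.1 - v) <= p (w.1 + v) - w.2.
  move=> Gu Gw; have := dG _ (lG 1 _ _ Gu Gw); rewrite /= !scale1r.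
  have := pD (u.1 - v) (w.1 + v); rewrite addrACA addNr addr0; lra.
have E0 : E !=set0 by exact: image_nonempty (ex_intro _ _ G0).
have ubE : has_ubound E.
  by exists (p (0 + v) - 0) => _ [u Gu <-]; exact: (sepE u 0).
exists (sup E); split=> [a _ _ [u Gu [b _ <-]] [w Gw [d _ <-]]|].
  exists (a *: u + w); first exact: lG.
  by exists (a * b + d) => //; rewrite scalerDr scalerDl scalerA addrACA.
move=> _ [u Gu [a _ <-]] /=.
(* Rescaling by [b^-1] reduces the coefficients [- b] and [b] of [v] to -1 and 1, since [p] is
   positively homogeneous. *)
have le_sup b : 0 < b -> u.2 - b * sup E <= p (u.1 - b *: v).
  move=> b0; have := ub_le_sup ubE (imageP _ (dominated_graphZ b^-1 gG Gu)).
  rewrite -/E /= lerBlDr -lerBlDl => /(ler_wpM2l (ltW b0)).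
  rewrite -(pZ _ (ltW b0)) scalerBr scalerA mulrBr [_ *: u.2]/(_ * _) mulrA.
  by rewrite divff ?gt_eqF// scale1r mul1r.
have sup_le b : 0 < b -> u.2 + b * sup E <= p (u.1 + b *: v).
  move=> b0; have := dominated_graphZ b^-1 gG Gu; set w := b^-1 *: u => Gw.
  have : sup E <= p (w.1 + v) - w.2.
    by apply: ge_sup => // _ [u' Gu' <-]; exact: sepE.
  rewrite lerBrDl => /(ler_wpM2l (ltW b0)).
  rewrite -(pZ _ (ltW b0)) scalerDr scalerA mulrDr [w.2]/(_ * _) mulrA.
  by rewrite divff ?gt_eqF// scale1r mul1r.
have [a0|a0|->] := ltgtP a 0; last by rewrite !scale0r !addr0 dG.
- have := le_sup (- a); rewrite oppr_gt0 => /(_ a0).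
  by rewrite mulNr opprK scaleNr opprK.
- exact: sup_le.
Qed.

Theorem hahn_banach (G : set (V * R^o)) : dominated_graph G -> G !=set0 ->
  exists f : V -> R^o, [/\ linear f, forall x, f x <= p x
    & forall u, G u -> f u.1 = u.2].
Proof.
move=> gG G0.
(* The guard [A !=set0] only serves the union of the empty chain. *)
pose P A := dominated_graph A /\ (A !=set0 -> G `<=` A).
have [|M [[gM GM] maxM]] := @Zorn_bigcup _ P.
  move=> F FP totF; split; last first.
    move=> [u [A FA Au]]; have [_ GA] := FP _ FA.
    by move=> w Gw; exists A => //; apply: GA => //; exists u.
  split=> [a u w [A FA Au] [B FB Bw]|u [A FA Au]]; last first.
    by have [[_ +] _] := FP _ FA; exact.
  have [AB|BA] := totF _ _ FA FB.
    by exists B => //; have [[+ _] _] := FP _ FB; apply=> //; exact: AB.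
  by exists A => //; have [[+ _] _] := FP _ FA; apply=> //; exact: BA.
(* Were [M] empty, [G] would be a strictly larger member of [P]. *)
have M0 : M !=set0.
  apply: contrapT => M0; have PG : P G by split=> // _ u.
  suff : M `<` G by move=> /maxM/(_ PG).
  split=> [u Mu|]; first by exfalso; apply: M0; exists u.
  by move=> GM'; case: G0 => u /GM' Mu; apply: M0; exists u.
have {}M0 := dominated_graph0 gM M0.
(* By maximality, extending [M] along [x] adds no point, so [x] is already in its domain. *)
have domM x : exists r, M (x, r).
  have [c gN] := dominated_graph_extend x gM M0.
  set N := (X in dominated_graph X) in gN.
  have MN : M `<=` N by move=> u Mu; exists u => //; exists 0; rewrite // scale0r addr0.
  have Nxc : N (x, c) by exists 0 => //; exists 1; rewrite // scale1r add0r.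
  have [NM|nNM] := pselect (N `<=` M); first by exists c; exact: NM.
  have PN : P N by split=> // _; apply: subset_trans MN; apply: GM; exists 0.
  by have /maxM/(_ PN) : M `<` N by [].
have [f fM] := choice domM.
exists f; split=> [a x y|x|[x r] Gu].
- have [lM _] := gM.
  exact: dominated_graph_fun gM (fM _) (lM a _ _ (fM x) (fM y)).
- by have [_ /(_ _ (fM x))] := gM.
- apply: dominated_graph_fun gM (fM _) _.
  by apply: GM => //; exists 0.
Qed.

End hahn_banach.

(** * Norming functionals, norm attainment, and functionals on the space of compact operators *)

Section functionals.
Context {R : realType}.
Implicit Types X Y Z : normedModType R.

Lemma bounded_linear_blinear X Y (f : X -> Y) (M : R) :
  linear f -> (forall x, `|f x| <= M * `|x|) -> f \in blinear.
Proof.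
move=> lf fM; apply/blinearP; split=> //.
pose L : {linear X -> Y} :=
  HB.pack f (GRing.isLinear.Build R X Y *:%R f lf).
apply: (@bounded_linear_continuous _ _ _ L).
apply/bounded_funP => r; exists (`|M| * r) => x xr.
by rewrite (le_trans (fM x))// (le_trans (ler_norm _))// normrM normr_id ler_wpM2l.
Qed.

Lemma opnorm_le_bound X Y (f : blinop X Y) (M : R) : 0 <= M ->
  (forall x, `|f x| <= M * `|x|) -> opnorm f <= M.
Proof.
move=> M0 fM; apply: opnorm_le => x x1.
by rewrite (le_trans (fM x))// ler_piMr.
Qed.

(** Hahn-Banach, with the norm as [p], extends the functional on the line through [x] that sends [x]
    to its norm. *)
Lemma norming_functional X (x : X) : x != 0 ->
  exists f : dual X, `|f| = 1 /\ f x = `|x|.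
Proof.
move=> x0; have nx : 0 < `|x| by rewrite normr_gt0.
pose G := [set ((a *: x, a * `|x|) : X * R^o) | a in [set: R]].
have [||||f [lf fle fG]] := @hahn_banach R X (fun y : X => `|y|) _ _ G.
- exact: ler_normD.
- by move=> a y a0; rewrite normrZ ger0_norm.
- split=> [a _ _ [b _ <-] [c _ <-]|_ [a _ <-]] /=.
    exists (a * b + c) => //; congr pair; first by rewrite scalerDl -scalerA.
    by rewrite mulrDl -mulrA.
  by rewrite normrZ ler_wpM2r// ler_norm.
- by exists 0, 0; rewrite // scale0r mul0r.
(* Domination is one-sided; applying it to [- y] too bounds the absolute value. *)
have fM y : `|f y| <= 1 * `|y|.
  have fN : f (- y) = - f y.
    have := lf (-1) y 0; rewrite !scaleN1r addr0 => ->.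
    by have := lf (-1) 0 0; rewrite !scaleN1r oppr0 addr0 addNr => ->; rewrite addr0.
  by rewrite mul1r ler_norml fle lerNl -fN (le_trans (fle _))// normrN.
pose F : dual X := BLinOp (bounded_linear_blinear lf fM).
have Fx : F x = `|x|.
  have : G (x, `|x|) by exists 1; rewrite // scale1r mul1r.
  exact: fG.
exists F; split=> //; apply/eqP; rewrite eq_le opnorm_le_bound//=.
have := ler_opnorm F x; rewrite Fx normr_id -{1}[`|x|]mul1r.
by rewrite ler_pM2r.
Qed.

Lemma dual_separates X (x y : X) : (forall f : dual X, f x = f y) -> x = y.
Proof.
move=> fxy; apply/eqP; rewrite -subr_eq0; apply/negPn/negP => xy0.
have [f [_]] := norming_functional xy0.
by rewrite linearB /= fxy subrr => /esym/eqP; rewrite normr_eq0 (negPf xy0).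
Qed.

(** A functional norming [f] is evaluation at some [x] by reflexivity; testing it on a functional
    norming [x] puts [x] in the unit ball. *)
Lemma reflexive_norm_attained X (f : dual X) : reflexive_space X ->
  exists2 x : X, `|x| <= 1 & f x = `|f|.
Proof.
move=> reflX; have [->|f0] := eqVneq f 0.
  by exists 0; rewrite normr0// linear0.
have [phi [phi1 phif]] := norming_functional f0.
have [x _ xphi] := reflX phi I.
exists x; last by rewrite -phif -xphi.
have [->|x0] := eqVneq x 0; first by rewrite normr0.
have [g [g1 gx]] := norming_functional x0.
have := ler_opnorm phi g; rewrite -[opnorm phi]/(`|phi|) phi1 g1 mulr1.
by rewrite -xphi /= gx normr_id.
Qed.

Lemma blinop_comp_subproof X Y Z (g : blinop Y Z) (f : blinop X Y) :
  (g \o f : X -> Z) \in blinear.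
Proof.
apply/blinearP; split=> [a x y|x] /=; first by rewrite !linearP.
by apply: continuous_comp; exact: blinop_continuous.
Qed.

Definition blinop_comp X Y Z (g : blinop Y Z) (f : blinop X Y) : blinop X Z :=
  BLinOp (blinop_comp_subproof g f).

Lemma compact_norm_attained X Y (T : compop X Y) : reflexive_space X ->
  exists2 x : X, `|x| <= 1 & `|T x| = `|T|.
Proof.
move=> reflX; pose K := closure (T @` unit_ball X).
have TK x : `|x| <= 1 -> K (T x) by move=> x1; apply: subset_closure; exists x.
have [|||y yK ymax] := @compact_EVT_max _ R (fun y : Y => `|y|) K.
- by exists (T 0); apply: TK; rewrite normr0.
- by rewrite -precompactE; apply/compact_opP/compop_blinopP.
- by apply: continuous_subspaceT => z; exact: norm_continuous.
have Ty : `|T| <= `|y|.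
  by apply: opnorm_le => x x1; apply: ymax; rewrite inE; exact: TK.
have [y0|y0] := eqVneq y 0.
  exists 0; first by rewrite normr0.
  apply/eqP; rewrite linear0 normr0 eq_sym -normr_le0 normr_id.
  by rewrite (le_trans Ty)// y0 normr0.
have [g [g1 gy]] := norming_functional y0.
pose gT : dual X := blinop_comp g T.
have [x x1 gTx] := reflexive_norm_attained gT reflX.
exists x => //; apply/eqP; rewrite eq_le opnorm_ub//= (le_trans Ty)//.
(* On the image of the unit ball [g] is at most the norm of [gT]; this passes to the closure because
   the half-space [H] is closed. *)
have ygT : `|y| <= `|gT|.
  pose H : set Y := [set z | g z <= `|gT|].
  have cH : closed H.
    apply: (preimage_closed _ (@closed_le R _)) => z _.
    exact: blinop_continuous.
  rewrite -gy; move: yK; rewrite inE; apply: (_ : K `<=` H).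
  rewrite ((closure_id H).1 cH); apply: closureS => _ [z z1 <-].
  exact: le_trans (ler_norm _) (opnorm_ub gT z1).
have := ler_opnorm g (T x); rewrite -[opnorm g]/(`|g|) g1 mul1r.
by apply: le_trans; rewrite (le_trans ygT)// -gTx ler_norm.
Qed.

Lemma rank_one_subproof X Y (h : dual X) (w : Y) :
  (fun x => h x *: w) \in @blinear R X Y.
Proof.
apply: (@bounded_linear_blinear _ _ _ (`|h| * `|w|)) => [a x y|x].
  by rewrite linearP scalerDl scalerA.
by rewrite normrZ mulrAC ler_wpM2r// ler_opnorm.
Qed.

(** The unit ball is sent into the multiples of [w] with coefficients in a compact interval. *)
Lemma rank_one_compact X Y (h : dual X) (w : Y) :
  BLinOp (rank_one_subproof h w) \in compact_op.
Proof.
apply/compact_opP.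
apply: (@precompact_subset _ _ ((fun r : R => r *: w) @` `[- `|h|, `|h|])).
  move=> _ [x x1 <-]; exists (h x) => //=.
  by rewrite in_itv /= -ler_norml opnorm_ub.
apply: compact_precompact; first exact: norm_hausdorff.
apply: continuous_compact; last exact: segment_compact.
by apply: continuous_subspaceT => r; exact: scalel_continuous.
Qed.

Definition rank_one X Y (h : dual X) (w : Y) : compop X Y :=
  CompOp (rank_one_compact h w).

Lemma eval_functional_le X Y (x : X) (g : dual Y) (S : compop X Y) :
  `|g (S x)| <= `|g| * `|x| * `|S|.
Proof.
rewrite -mulrA (le_trans (ler_opnorm g _))// ler_wpM2l ?opnorm_ge0//.
by rewrite mulrC; exact: ler_opnorm.
Qed.

Lemma eval_functional_subproof X Y (x : X) (g : dual Y) :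
  (fun S : compop X Y => g (S x) : R^o) \in blinear.
Proof.
apply: (bounded_linear_blinear _ (eval_functional_le x g)) => a S U.
by rewrite -[(a *: S + U) x]/(a *: S x + U x) linearP.
Qed.

Definition eval_functional X Y (x : X) (g : dual Y) : dual (compop X Y) :=
  BLinOp (eval_functional_subproof x g).

Definition supports Z (u : Z) (f : dual Z) := `|f| = 1 /\ f u = `|u|.

(** The norm is at most 1 since [g] and [x] have norm 1, and the value at [T] shows that 1 is
    reached. *)
Lemma eval_functional_supports X Y (T : compop X Y) (x : X) (g : dual Y) :
  T != 0 -> `|x| = 1 -> `|T x| = `|T| -> supports (T x) g ->
  supports T (eval_functional x g).
Proof.
move=> T0 x1 Tx [g1 gTx]; have gT : g (T x) = `|T| by rewrite gTx.
split=> //; apply/eqP; rewrite eq_le; apply/andP; split.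
  apply: opnorm_le_bound => // S.
  by rewrite -{1}g1 -[X in X * `|S|]mulr1 -x1 eval_functional_le.
have := ler_opnorm (eval_functional x g) T.
rewrite /= gT normr_id -{1}[`|T|]mul1r ler_pM2r// normr_gt0//.
Qed.

End functionals.

(** * Norm-attaining vectors of a smooth compact operator *)

Unset Implicit Arguments.

Theorem theorem4p2 (R : realType) (X : completeNormedModType R)
    (Y : normedModType R) (HX : reflexive_space X) (T : compop X Y) :
  smooth_point T ->
  exists2 x0 : X, x0 \in unit_sphere X &
    [set x | x \in unit_sphere X /\ `|T x| = `|T|] = [set x0; - x0] /\
    smooth_point (T x0).
Proof.
move=> [T0 [phi [_ phi_uniq]]].
have nT : `|T| != 0 by rewrite normr_eq0.
have [x0 x0_le Tx0] := compact_norm_attained T HX.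
(* As [T] is non-zero, a norm-attaining vector of the ball cannot have norm below 1. *)
have x01 : `|x0| = 1.
  apply/eqP; rewrite eq_le x0_le/=.
  have := ler_opnorm T x0; rewrite Tx0 -[opnorm T]/(`|T|).
  by rewrite -{1}[`|T|]mulr1 ler_pM2l// normr_gt0.
have Tx_neq0 x : `|T x| = `|T| -> T x != 0 by rewrite -normr_eq0 => ->.
have tensor_eq x y (g k : dual Y) (h : dual X) (w : Y) :
    `|x| = 1 -> `|T x| = `|T| -> supports (T x) g ->
    `|y| = 1 -> `|T y| = `|T| -> supports (T y) k ->
    h x * g w = h y * k w.
  move=> x1 Tx gx y1 Ty ky.
  have : eval_functional x g = eval_functional y k.
    rewrite -(phi_uniq _ (eval_functional_supports T0 x1 Tx gx)).
    exact: phi_uniq (eval_functional_supports T0 y1 Ty ky).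
  move=> /(congr1 (fun f : dual _ => f (rank_one h w))) /=.
  by rewrite !linearZ.
have [g gx0] := norming_functional (Tx_neq0 _ Tx0).
have [_ gTx0] := gx0.
exists x0; first by rewrite inE.
split.
  apply/seteqP; split=> [x [/[!inE] x1 Tx]|x].
    have [k kx] := norming_functional (Tx_neq0 _ Tx).
    (* [tensor_eq] with [w] equal to [T x0] shows that every [h] takes the same value at [x0] and at
       [c *: x]. *)
    pose c := k (T x0) / `|T|.
    have x0E : x0 = c *: x.
      apply: dual_separates => h; rewrite linearZ /= /c.
      have := tensor_eq x0 x g k h (T x0) x01 Tx0 gx0 x1 Tx kx.
      rewrite gTx0 Tx0 => /(congr1 (fun r => r / `|T|)); rewrite mulfK// => ->.
      by rewrite -mulrA mulrC.
    have c1 : `|c| = 1 by move: x01; rewrite x0E normrZ x1 mulr1.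
    rewrite x0E; have [c0|c0] := leP 0 c.
      by left; rewrite -(ger0_norm c0) c1 scale1r.
    by right; rewrite -scaleNr -(ltr0_norm c0) c1 scale1r.
  by case=> ->; rewrite /= inE /unit_sphere /= ?linearN /= ?normrN.
split; first exact: Tx_neq0.
exists g; split=> // k kx0; apply: blinopP => w.
have x0_neq0 : x0 != 0 by rewrite -normr_eq0 x01 oner_neq0.
(* An [h] with [h x0 = 1] makes [tensor_eq] read [g w = k w]. *)
have [h [_ hx0]] := norming_functional x0_neq0.
have := tensor_eq x0 x0 g k h w x01 Tx0 gx0 x01 Tx0 kx0.
by rewrite hx0 x01 !mul1r.
Qed.
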